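(* Let $p>1$ be a real number and let $\mu,\nu$ be two positive measures on $\mathbb{N}^*$. Let $C_{\mu,\nu}\in(0,+\infty]$ be the smallest constant such that $$\sum_{x\in\mathbb{N}^*}\left|\sum_{y=1}^{x}f(y)\right|^p\mu(x)\le C_{\mu,\nu}\sum_{x\in\mathbb{N}^*}|f(x)|^p\,\nu(x)\qquad\text{for all } f:\mathbb{N}^*\to\mathbb{R},$$ and let $$B^{(1)}_{\mu,\nu}=\sup_{r\ge1}\left[\left(\sum_{x=r}^{\infty}\mu(x)\right)\left(\sum_{x=1}^{r}\frac{1}{\nu(x)^{\frac1{p-1}}}\right)^{p-1}\right].$$ Then $C_{\mu,\nu}<\infty$ if and only if $B^{(1)}_{\mu,\nu}<\infty$. In this case, $$B^{(1)}_{\mu,\nu}\le C_{\mu,\nu}\le\frac{p^p}{(p-1)^{p-1}}\,B^{(1)}_{\mu,\nu}.$$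
   Context: $\mathbb{N}^*=\{1,2,3,\dots\}$. A positive measure $\mu$ on $\mathbb{N}^*$ is identified with its weights $\mu(n)\in(0,\infty)$, $n\ge1$. Sums of nonnegative terms take values in $[0,+\infty]$; $C_{\mu,\nu}=+\infty$ means that no finite constant works. *)

(* Defs.v *)
From HB Require Import structures.
From mathcomp Require Import all_boot all_order all_algebra.
From mathcomp Require Import all_classical all_reals all_analysis.

Set Implicit Arguments.
Unset Strict Implicit.
Unset Printing Implicit Defensive.

Import Order.TTheory GRing.Theory Num.Theory.
Import numFieldNormedType.Exports.

Local Open Scope classical_set_scope.
Local Open Scope ring_scope.
Local Open Scope ereal_scope.

(* Functions on {1, 2, 3, ...} are represented by functions on [nat] whose
   value at 0 is never used: all sums below start at 1 or later. *)

Definition hardy_lhs (R : realType) (p : R) (mu f : nat -> R) : \bar R :=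
  \sum_(1 <= x <oo)
    ((`|\sum_(1 <= y < x.+1) f y| `^ p * mu x)%R)%:E.

Definition hardy_rhs (R : realType) (p : R) (nu f : nat -> R) : \bar R :=
  \sum_(1 <= x <oo) ((`|f x| `^ p * nu x)%R)%:E.

(* The infimum of the finite admissible constants, hence +oo if there are none.
   It is a minimum: see [hardy_const_gt0], [hardy_const_admissible] and
   [hardy_const_le]. *)
Definition hardy_const (R : realType) (p : R) (mu nu : nat -> R) : \bar R :=
  ereal_inf [set C%:E | C in [set C : R | (0 < C)%R /\
    forall f : nat -> R, hardy_lhs p mu f <= C%:E * hardy_rhs p nu f]].

Definition hardy_B1 (R : realType) (p : R) (mu nu : nat -> R) : \bar R :=
  ereal_sup [set (\sum_(r <= x <oo) (mu x)%:E) *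
      (((\sum_(1 <= x < r.+1) (nu x `^ (p - 1)^-1)^-1) `^ (p - 1))%R)%:E
    | r in [set r : nat | (1 <= r)%N]].

Lemma term_ge0 (R : realType) (p : R) (w g : nat -> R) :
    (forall n : nat, (1 <= n)%N -> (0 < w n)%R) ->
  forall n : nat, (1 <= n)%N -> true -> 0 <= ((`|g n| `^ p * w n)%R)%:E.
Proof. by move=> hw n hn _; rewrite lee_fin mulr_ge0 ?powR_ge0// ltW ?hw. Qed.

Lemma rhs_ge (R : realType) (p : R) (nu f : nat -> R) (n : nat)
    (hnu : forall n : nat, (1 <= n)%N -> (0 < nu n)%R) : (1 <= n)%N ->
  ((`|f n| `^ p * nu n)%R)%:E <= hardy_rhs p nu f.
Proof.
move=> hn; apply: le_trans (nneseries_lim_ge n.+1 (@term_ge0 R p nu f hnu)).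
rewrite big_nat_recr//= leeDr//; rewrite big_nat_cond; apply: sume_ge0 => i.
by move=> /andP[/andP[i1 _] _]; exact: term_ge0.
Qed.

Lemma hardy_const_gt0 (R : realType) (p : R) (mu nu : nat -> R)
    (hp : (1 < p)%R)
    (hmu : forall n : nat, (1 <= n)%N -> (0 < mu n)%R)
    (hnu : forall n : nat, (1 <= n)%N -> (0 < nu n)%R) : 0 < hardy_const p mu nu.
Proof.
have p_neq0 : p != 0%R by rewrite gt_eqF// (lt_trans ltr01).
pose d : nat -> R := fun n => (n == 1%N)%:R%R.
apply: (@lt_le_trans _ _ ((mu 1%N / nu 1%N)%R)%:E).
  by rewrite lte_fin divr_gt0 ?hmu ?hnu.
apply: le_ereal_inf_tmp => _ [C [C0 /(_ d) hC] <-].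
have rhsE : hardy_rhs p nu d = (nu 1%N)%:E.
  rewrite /hardy_rhs (nneseries_split 1 1); last first.
    by move=> k hk; exact: (@term_ge0 R p nu d hnu k hk isT).
  rewrite addn1 big_nat1 eseries0 ?adde0 => [|i i2 _].
    by rewrite /d eqxx normr1 powR1 mul1r.
  by rewrite /d gtn_eqF// normr0 powR0// mul0r.
have lhsE : (mu 1%N)%:E <= hardy_lhs p mu d.
  apply: le_trans (nneseries_lim_ge 2
    (@term_ge0 R p mu (fun x => (\sum_(1 <= y < x.+1) d y)%R) hmu)).
  by rewrite big_nat1 big_nat1 /d eqxx normr1 powR1 mul1r.
rewrite rhsE in hC; move: (le_trans lhsE hC).
by rewrite -EFinM !lee_fin ler_pdivrMr ?hnu.
Qed.

Lemma hardy_const_admissible (R : realType) (p : R) (mu nu : nat -> R)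
    (hp : (1 < p)%R)
    (hmu : forall n : nat, (1 <= n)%N -> (0 < mu n)%R)
    (hnu : forall n : nat, (1 <= n)%N -> (0 < nu n)%R)
    (f : nat -> R) :
  hardy_lhs p mu f <= hardy_const p mu nu * hardy_rhs p nu f.
Proof.
have p_neq0 : p != 0%R by rewrite gt_eqF// (lt_trans ltr01).
have : 0 <= hardy_rhs p nu f by apply: nneseries_ge0; exact: term_ge0.
case E : (hardy_rhs p nu f) => [s| |]//; last first.
  by move=> _; rewrite gt0_muley ?leey //; exact: hardy_const_gt0.
rewrite lee_fin le_eqVlt => /predU1P[s0|s0].
  have f0 n : (1 <= n)%N -> f n = 0%R.
    move=> hn; have := rhs_ge p f hnu hn; rewrite E -s0 lee_fin => h.
    apply/eqP/negP => /negP fn0; move: h; apply/negP; rewrite -ltNge.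
    by rewrite mulr_gt0 ?hnu// powR_gt0// normr_gt0.
  rewrite -s0 mule0 /hardy_lhs eseries0// => i i1 _.
  rewrite big_nat_cond big1 ?normr0 ?powR0 ?mul0r// => j.
  by case/andP => /andP[j1 _] _; exact: f0.
rewrite -lee_pdivrMr//; apply: le_ereal_inf_tmp => _ [C [C0 /(_ f) hC] <-].
by rewrite lee_pdivrMr// -E.
Qed.

Lemma hardy_const_le (R : realType) (p : R) (mu nu : nat -> R) (C : \bar R) : 0 < C ->
  (forall f : nat -> R, hardy_lhs p mu f <= C * hardy_rhs p nu f) ->
  hardy_const p mu nu <= C.
Proof.
case: C => [c| |]// c0 hC; last exact: leey.
by apply: ereal_inf_lbound; exists c.
Qed.

(* Main.v *)
(** Write [S x] for the sum of [nu^(-1/(p-1))] over [1, x], [M x] for the tail of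
    [mu] from [x] on, and [u = 1 - 1/p].

    Lower bound: test the inequality on [f = nu^(-1/(p-1))] cut off after [r].

    Upper bound (Muckenhoupt's argument): Hölder's inequality with the weights
    [nu^(-1/(p-1)) * S^(u-1)] gives
      [|f 1 + ... + f x|^p <=
         (S x ^ u / u)^(p-1) * sum_(y <= x) |f y|^p * nu y * S y ^ u].
    Exchange the two sums and bound [S x ^ (u * (p-1))] by [B^u * M x ^ (-u)];
    concavity gives [sum_(x >= y) mu x * M x ^ (-u) <= p * M y ^ (1/p)], and
    [S y ^ u * M y ^ (1/p) <= B^(1/p)]. Everything is done for sums truncated at
    a finite rank, with [M] the truncated tail, and the rank is then let go to
    infinity. *)
Require Import Defs.
From HB Require Import structures.
From mathcomp Require Import all_boot all_order all_algebra.
From mathcomp Require Import all_classical all_reals all_analysis.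
From mathcomp Require Import ring lra.

Set Implicit Arguments.
Unset Strict Implicit.
Unset Printing Implicit Defensive.

Import Order.TTheory GRing.Theory Num.Theory.
Import numFieldNormedType.Exports.
Local Open Scope ring_scope.

(** * Convexity of powers and Hölder's inequality *)

(** A concave power lies below its tangent at [b]. This is Young's inequality for [(a / b) ^ t] and
    [1] with exponents [1/t] and [1/(1-t)], scaled by [b ^ t]. *)
Lemma powR_tangent_le (R : realType) (t a b : R) : 0 < t < 1 ->
  0 <= a -> 0 < b -> a `^ t <= b `^ t + t * b `^ (t - 1) * (a - b).
Proof.
move=> /andP[t0 t1] a0 b0.
have t1' : 0 < 1 - t by rewrite subr_gt0.
have := @conjugate_powR R ((a / b) `^ t) 1 t^-1 (1 - t)^-1 (powR_ge0 _ _) ler01.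
rewrite !invr_gt0 !invrK t0 t1' mulr1 powR1 mul1r -powRrM mulfV ?gt_eqF//.
have ab0 : 0 <= a / b by rewrite divr_ge0// ltW.
rewrite powRr1// addrC subrK => /(_ isT isT erefl).
rewrite -(ler_pM2r (powR_gt0 t b0)) -powRM ?(ltW b0)// divfK ?gt_eqF//.
suff -> : (a / b * t + (1 - t)) * b `^ t = b `^ t + t * b `^ (t - 1) * (a - b).
  by [].
by rewrite -(mulr_powRB1 _ t0) ?(ltW b0)//; field; rewrite gt_eqF.
Qed.

(** Convex counterpart: Young's inequality for [a / b] and [1] with exponents [p] and [p/(p-1)],
    scaled by [p * b ^ p]. *)
Lemma powR_tangent_ge (R : realType) (p a b : R) : 1 < p ->
  0 <= a -> 0 <= b -> b `^ p + p * b `^ (p - 1) * (a - b) <= a `^ p.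
Proof.
move=> p1 a0; have p0 : 0 < p by exact: lt_trans p1.
(* At [b = 0] the quotient [a / b] is useless, but the tangent is the zero line since
   [p - 1 > 0]. *)
rewrite le_eqVlt => /predU1P[<-|b0].
  by rewrite !powR0 ?subr_eq0 ?gt_eqF// mulr0 mul0r addr0 powR_ge0.
have := @conjugate_powR R (a / b) 1 p (1 - p^-1)^-1.
have p1' : 0 < 1 - p^-1 by rewrite subr_gt0 invf_lt1.
rewrite divr_ge0 ?(ltW b0)// ler01 p0 invr_gt0 p1' invrK powR1 mul1r mulr1.
rewrite subrKC => /(_ isT isT isT isT erefl).
rewrite -(ler_pM2r (powR_gt0 p b0)) mulrDl [(_ / p) * _]mulrAC.
rewrite -powRM ?divr_ge0 ?(ltW b0)//.
rewrite divfK ?gt_eqF// -(ler_pM2l p0) mulrDr [(p * (_ / p))]mulrCA.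
rewrite mulfV ?gt_eqF// mulr1.
rewrite -(mulr_powRB1 _ p0) ?(ltW b0)//.
have -> : p * (a / b * (b * b `^ (p - 1))) = p * a * b `^ (p - 1).
  by field; rewrite gt_eqF.
have -> : p * ((1 - p^-1) * (b * b `^ (p - 1))) = (p - 1) * b * b `^ (p - 1).
  by field; rewrite gt_eqF.
by lra.
Qed.

(** Hölder's inequality in Jensen's form: average the tangent inequality at the mean [G / A] with
    weights [a]; the linear terms cancel. *)
Lemma powR_sum_le (R : realType) (I : Type) (r : seq I) (P : pred I)
    (p : R) (a g : I -> R) : 1 < p -> 0 < \sum_(i <- r | P i) a i ->
  (forall i, P i -> 0 <= a i) -> (forall i, P i -> 0 <= g i) ->
  (\sum_(i <- r | P i) a i * g i) `^ p <=
   (\sum_(i <- r | P i) a i) `^ (p - 1) * \sum_(i <- r | P i) a i * g i `^ p.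
Proof.
move=> p1; set A := \sum_(i <- r | P i) a i; set G := \sum_(i <- r | P i) a i * g i.
move=> A0 a0 g0; have p0 : 0 < p by exact: lt_trans p1.
have G0 : 0 <= G by apply: sumr_ge0 => i Pi; rewrite mulr_ge0 ?g0 ?a0.
have GA0 : 0 <= G / A by rewrite divr_ge0// ltW.
have : \sum_(i <- r | P i) a i * ((G / A) `^ p + p * (G / A) `^ (p - 1) * (g i - G / A))
    <= \sum_(i <- r | P i) a i * g i `^ p.
  by apply: ler_sum => i Pi; rewrite ler_wpM2l ?a0// powR_tangent_ge ?g0.
under eq_bigr do rewrite mulrDr mulrCA mulrBr mulrBr.
rewrite big_split/= -mulr_suml sumrB/= -!mulr_sumr -mulr_suml -/A -/G.
rewrite (mulrC A (G / A)) divfK ?gt_eqF// subrr addr0 => h.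
apply: le_trans (ler_wpM2l (powR_ge0 A (p - 1)) h).
by rewrite mulrA (mulrC _ A) mulr_powRB1 ?(ltW A0)// -powRM ?(ltW A0)// mulrC divfK ?gt_eqF.
Qed.

(** * Discrete integration of powers of partial sums *)

Lemma sum_nat_gt0 (R : realType) (w : nat -> R) (m n : nat) :
  (forall n, (1 <= n)%N -> 0 < w n) -> (1 <= m < n)%N -> 0 < \sum_(m <= i < n) w i.
Proof.
move=> w_gt0 /andP[m1 mn]; rewrite big_ltn// ltr_wpDr ?w_gt0// big_nat sumr_ge0// => i.
by move=> /andP[mi _]; rewrite ltW// w_gt0// (leq_trans _ mi).
Qed.

Lemma sum_nat_ge0 (R : realType) (w : nat -> R) (m n : nat) :
  (forall n, (1 <= n)%N -> 0 < w n) -> (1 <= m)%N -> 0 <= \sum_(m <= i < n) w i.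
Proof.
move=> w_gt0 m1; rewrite big_nat sumr_ge0// => i /andP[mi _].
by rewrite ltW// w_gt0// (leq_trans _ mi).
Qed.

(** Discrete form of integrating [W ^ (t-1) dW]. The tangent at the larger of two consecutive
    partial sums, the one known to be positive, bounds each term by an increment of [W ^ t / t], and
    these telescope. *)
Lemma sum_prefix_powR_le (R : realType) (t : R) (w : nat -> R) (n : nat) :
  0 < t < 1 -> (forall n, (1 <= n)%N -> 0 < w n) ->
  \sum_(1 <= y < n.+1) w y * (\sum_(1 <= z < y.+1) w z) `^ (t - 1) <=
  t^-1 * (\sum_(1 <= z < n.+1) w z) `^ t.
Proof.
move=> t01 w_gt0; have /andP[t0 t1] := t01; elim: n => [|n IH].
  by rewrite !big_geq// mulr_ge0 ?powR_ge0// invr_ge0 ltW.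
rewrite big_nat_recr//=; apply: le_trans (lerD IH (lexx _)) _.
rewrite -(ler_pM2l t0) mulrDr !mulVKf ?gt_eqF//.
have := @powR_tangent_le _ t (\sum_(1 <= z < n.+1) w z) (\sum_(1 <= z < n.+2) w z) t01
  (@sum_nat_ge0 _ _ 1 n.+1 w_gt0 isT) (@sum_nat_gt0 _ _ 1 n.+2 w_gt0 isT).
by rewrite [\sum_(1 <= z < n.+2) w z]big_nat_recr//=; lra.
Qed.

(** The same telescoping for tails, by induction on the length [n - m] because the lower endpoint
    moves. *)
Lemma sum_suffix_powR_le (R : realType) (t : R) (w : nat -> R) (m n : nat) :
  0 < t < 1 -> (forall n, (1 <= n)%N -> 0 < w n) -> (1 <= m)%N ->
  \sum_(m <= x < n) w x * (\sum_(x <= z < n) w z) `^ (t - 1) <=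
  t^-1 * (\sum_(m <= z < n) w z) `^ t.
Proof.
move=> t01 w_gt0; have /andP[t0 t1] := t01; have [k] := ubnP (n - m); elim: k m => // k IH m nmk m1.
have [nm|mn] := leqP n m.
  by rewrite !big_geq// mulr_ge0 ?powR_ge0// invr_ge0 ltW.
rewrite big_ltn//; apply: le_trans (lerD (lexx _) (IH m.+1 _ isT)) _.
  by rewrite subnS; case: (n - m)%N nmk (subn_gt0 m n) => //=; rewrite mn.
rewrite -(ler_pM2l t0) mulrDr !mulVKf ?gt_eqF//.
have := @powR_tangent_le _ t (\sum_(m.+1 <= z < n) w z) (\sum_(m <= z < n) w z) t01
  (@sum_nat_ge0 _ _ m.+1 n w_gt0 isT) (@sum_nat_gt0 _ _ m n w_gt0 _).
by rewrite m1 mn [\sum_(m <= z < n) w z]big_ltn// => /(_ isT); lra.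
Qed.

Lemma exchange_big_nat_triangular (R : realType) (F : nat -> nat -> R) n :
  \sum_(1 <= x < n) \sum_(1 <= y < x.+1) F x y =
  \sum_(1 <= y < n) \sum_(y <= x < n) F x y.
Proof.
rewrite [RHS](eq_big_nat _ _ (F2 := fun y => \sum_(1 <= x < n | (y <= x)%N) F x y)).
  rewrite [LHS](eq_big_nat _ _ (F2 := fun x => \sum_(1 <= y < n | (y <= x)%N) F x y)).
    by rewrite (exchange_big_dep_nat xpredT).
  by move=> x /andP[_ xn]; rewrite (big_nat_widen _ _ n).
by move=> y /andP[y1 _]; rewrite (big_nat_widenl y 1).
Qed.

(** * The upper bound for truncated sums *)

Lemma hardy_finite (R : realType) (p b : R) (mu nu f : nat -> R) (n : nat) :
  1 < p -> (forall n, (1 <= n)%N -> 0 < mu n) ->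
  (forall n, (1 <= n)%N -> 0 < nu n) ->
  (forall r, (1 <= r < n)%N -> (\sum_(r <= x < n) mu x) *
    (\sum_(1 <= x < r.+1) (nu x `^ (p - 1)^-1)^-1) `^ (p - 1) <= b) ->
  \sum_(1 <= x < n) `|\sum_(1 <= y < x.+1) f y| `^ p * mu x <=
  p `^ p / (p - 1) `^ (p - 1) * b * \sum_(1 <= x < n) `|f x| `^ p * nu x.
Proof.
move=> p1 mu0 nu0; have p0 : 0 < p by exact: lt_trans p1.
have q0 : 0 < p - 1 by rewrite subr_gt0.
pose s x := (nu x `^ (p - 1)^-1)^-1.
have s0 k : (1 <= k)%N -> 0 < s k by move=> k1; rewrite invr_gt0 powR_gt0 ?nu0.
pose S x := \sum_(1 <= y < x.+1) s y; pose M x := \sum_(x <= z < n) mu z.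
have S0 x : (1 <= x)%N -> 0 < S x by move=> x1; rewrite /S sum_nat_gt0.
have M0 x : (1 <= x < n)%N -> 0 < M x by move=> x1n; rewrite /M sum_nat_gt0.
move=> hb; have {}hb r : (1 <= r < n)%N -> M r * S r `^ (p - 1) <= b by exact: hb.
pose u := 1 - p^-1.
have u0 : 0 < u by rewrite subr_gt0 invf_lt1.
have u01 : 0 < u < 1 by rewrite u0 ltrBlDr ltrDl invr_gt0.
have t01 : 0 < p^-1 < 1 by rewrite invr_gt0 p0 invf_lt1.
(* The weights [a y] are chosen so that their sums over [1, x] are at most
   [S x `^ u / u], by concavity. *)
pose a y := s y * S y `^ (u - 1).
have a0 y : (1 <= y)%N -> 0 < a y by move=> y1; rewrite mulr_gt0 ?powR_gt0 ?s0 ?S0.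
(* [a ^ (1-p) = nu * S ^ u], because [s ^ (1-p) = nu] and [(u-1) * (1-p) = u]. *)
have ag y : (1 <= y)%N -> a y * (`|f y| / a y) `^ p = `|f y| `^ p * nu y * S y `^ u.
  move=> y1; have ayP := a0 _ y1; rewrite powRM ?invr_ge0 ?(ltW ayP)// mulrCA -mulrA.
  congr (_ * _).
  have -> : a y * (a y)^-1 `^ p = a y `^ (1 - p).
    by rewrite -powR_inv1 ?ltW// -powRrM mulN1r powRD ?(gt_eqF ayP) ?implybT// powRr1// ltW.
  rewrite /a powRM ?powR_ge0 ?(ltW (s0 _ _))// -powRrM; congr (_ * _ `^ _).
    rewrite /s -powRN -powRrM mulNr -mulrN opprB mulVf ?gt_eqF//.
    by rewrite powRr1// ltW ?nu0.
  by rewrite /u; field; rewrite gt_eqF.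
have Fle x : (1 <= x < n)%N -> `|\sum_(1 <= y < x.+1) f y| `^ p <=
    (u^-1 * S x `^ u) `^ (p - 1) * \sum_(1 <= y < x.+1) `|f y| `^ p * nu y * S y `^ u.
  move=> /andP[x1 _]; apply: (@le_trans _ _ ((\sum_(1 <= y < x.+1) `|f y|) `^ p)).
    by rewrite ge0_ler_powR ?nnegrE ?sumr_ge0 ?ler_norm_sum// ltW.
  have A0 : 0 < \sum_(1 <= y < x.+1) a y by exact: sum_nat_gt0.
  rewrite -(eq_big_nat _ _ (F1 := fun y => a y * (`|f y| / a y))); last first.
    by move=> y /andP[y1 _]; rewrite mulrC divfK// gt_eqF ?a0.
  rewrite -[X in _ <= _ * X](eq_big_nat _ _
    (F1 := fun y => a y * (`|f y| / a y) `^ p)); last first.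
    by move=> y /andP[y1 _]; exact: ag.
  rewrite !big_nat; apply: le_trans (powR_sum_le p1 _ _ _) _.
  - by rewrite -big_nat.
  - by move=> y /andP[y1 _]; rewrite ltW ?a0.
  - by move=> y /andP[y1 _]; rewrite divr_ge0 ?(ltW (a0 _ _)).
  rewrite -!big_nat ler_wpM2r//.
    by rewrite big_nat sumr_ge0// => y /andP[y1 _]; rewrite mulr_ge0 ?powR_ge0 ?ltW ?a0.
  rewrite ge0_ler_powR ?nnegrE ?(ltW A0) ?(ltW q0)//.
    by rewrite mulr_ge0 ?powR_ge0// invr_ge0 ltW.
  exact: (sum_prefix_powR_le _ u01 s0).
have b0 x : (1 <= x < n)%N -> 0 < b.
  move=> x1n; apply: lt_le_trans (hb x x1n).
  by have /andP[x1 _] := x1n; rewrite mulr_gt0 ?M0 ?powR_gt0 ?S0.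
have Sle x : (1 <= x < n)%N -> S x `^ (p - 1) <= b / M x.
  by move=> x1n; rewrite ler_pdivlMr ?M0// mulrC hb.
(* Raise [Sle] to the power [u]; the exponent [p^-1 - 1] is [-u], the form that [sum_suffix_powR_le]
   takes with [t = 1/p]. *)
have SMle x : (1 <= x < n)%N ->
    (S x `^ u) `^ (p - 1) <= b `^ u * M x `^ (p^-1 - 1).
  move=> x1n; rewrite powRAC; have /andP[x1 _] := x1n.
  apply: (@le_trans _ _ ((b / M x) `^ u)).
    by rewrite ge0_ler_powR ?nnegrE ?powR_ge0 ?Sle ?(ltW u0)// divr_ge0 ?ltW ?M0 ?(b0 x).
  have /ltW bx0 := b0 _ x1n; have /ltW Mx0 := M0 _ x1n.
  by rewrite powRM ?invr_ge0// -powR_inv1// -powRrM mulN1r opprB.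
pose c := u^-1 `^ (p - 1).
have c0 : 0 <= c by exact: powR_ge0.
pose G y := `|f y| `^ p * nu y.
have G0 y : (1 <= y)%N -> 0 <= G y by move=> y1; rewrite mulr_ge0 ?powR_ge0// ltW ?nu0.
apply: (@le_trans _ _ (\sum_(1 <= x < n) \sum_(1 <= y < x.+1)
    c * b `^ u * (G y * S y `^ u * (mu x * M x `^ (p^-1 - 1))))).
  apply: ler_sum_nat => x x1n; have /andP[x1 _] := x1n.
  apply: le_trans (ler_wpM2r (ltW (mu0 _ x1)) (Fle _ x1n)) _.
  rewrite -mulr_sumr -mulr_suml powRM ?powR_ge0 ?invr_ge0 ?(ltW u0)// -/c.
  set T := \sum_(1 <= y < x.+1) _.
  have T0 : 0 <= T.
    by rewrite /T big_nat sumr_ge0// => y /andP[y1 _]; rewrite mulr_ge0 ?G0 ?powR_ge0.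
  rewrite [leLHS](_ : _ = c * T * mu x * (S x `^ u) `^ (p - 1)); last by ring.
  rewrite [leRHS](_ : _ = c * T * mu x * (b `^ u * M x `^ (p^-1 - 1))); last by ring.
  by rewrite ler_wpM2l ?SMle// !mulr_ge0 ?(ltW (mu0 _ _)).
rewrite exchange_big_nat_triangular mulr_sumr; apply: ler_sum_nat => y y1n.
have /andP[y1 _] := y1n.
rewrite -!mulr_sumr.
apply: (@le_trans _ _ (c * b `^ u * (G y * S y `^ u * (p * M y `^ p^-1)))).
  rewrite ler_wpM2l ?(mulr_ge0 c0) ?powR_ge0//.
  rewrite ler_wpM2l ?(mulr_ge0 (G0 _ _)) ?powR_ge0//.
  have := @sum_suffix_powR_le _ _ _ y n t01 mu0 y1; by rewrite invrK.
(* Since [u = (p-1)/p], the left side is [(S ^ (p-1) * M) ^ (1/p)]. *)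
have SM : S y `^ u * M y `^ p^-1 <= b `^ p^-1.
  have -> : S y `^ u = (S y `^ (p - 1)) `^ p^-1.
    by rewrite -powRrM /u mulrBl mulfV ?gt_eqF// mul1r.
  have /ltW My0 := M0 _ y1n.
  rewrite -powRM ?powR_ge0// ge0_ler_powR ?nnegrE ?invr_ge0 ?(ltW p0)//.
  - by rewrite mulr_ge0 ?powR_ge0 ?ltW ?M0.
  - by rewrite ltW ?(b0 y).
  - by rewrite mulrC hb.
(* [c = (p/(p-1)) ^ (p-1)] comes from Hölder's inequality, the extra factor [p] from the sum over
   tails. *)
have cE : c * p = p `^ p / (p - 1) `^ (p - 1).
  have -> : c = (p / (p - 1)) `^ (p - 1).
    by congr (_ `^ _); rewrite /u; field; rewrite !gt_eqF// subr_gt0 invf_lt1.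
  rewrite powRM ?invr_ge0 ?ltW// -[(p - 1)^-1]powR_inv1 ?ltW//.
  by rewrite powRAC powR_inv1 ?powR_ge0// mulrC mulrA mulr_powRB1 ?ltW.
have bE : b = b `^ u * b `^ p^-1.
  by rewrite -powRD ?subrK ?powRr1 ?(ltW (b0 _ y1n))// gt_eqF ?(b0 y) ?implybT.
rewrite -cE {2}bE -/(G y).
have -> : c * b `^ u * (G y * S y `^ u * (p * M y `^ p^-1)) =
  (c * p * b `^ u * G y) * (S y `^ u * M y `^ p^-1) by ring.
have -> : c * p * (b `^ u * b `^ p^-1) * G y = (c * p * b `^ u * G y) * b `^ p^-1.
  by ring.
by rewrite ler_wpM2l// (mulr_ge0 _ (G0 y y1))// !mulr_ge0 ?powR_ge0 ?(ltW p0).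
Qed.

(** * Infinite series and the lower bound *)

Lemma nneseries_le (R : realType) (u : nat -> R) (m : nat) (x : \bar R) :
  (forall n, (m <= n)%N -> 0 <= u n) ->
  (forall n, ((\sum_(m <= i < n) u i)%:E <= x)%E) ->
  (\sum_(m <= i <oo) (u i)%:E <= x)%E.
Proof.
move=> u0 ux; apply: lime_le.
  by apply: is_cvg_nneseries => i mi _; rewrite lee_fin u0.
by apply: nearW => n; rewrite sumEFin.
Qed.

Lemma nneseries_ge (R : realType) (u : nat -> R) (m n : nat) :
  (forall n, (m <= n)%N -> 0 <= u n) ->
  ((\sum_(m <= i < n) u i)%:E <= \sum_(m <= i <oo) (u i)%:E)%E.
Proof.
move=> u0; rewrite -sumEFin; apply: nneseries_lim_ge => i mi _.
by rewrite lee_fin u0.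
Qed.

Lemma hardy_B1_le (R : realType) (p C : R) (mu nu : nat -> R) : 1 < p ->
  (forall n : nat, (1 <= n)%N -> 0 < mu n) ->
  (forall n : nat, (1 <= n)%N -> 0 < nu n) ->
  (forall f : nat -> R, (hardy_lhs p mu f <= C%:E * hardy_rhs p nu f)%E) ->
  (hardy_B1 p mu nu <= C%:E)%E.
Proof.
move=> p1 mu0 nu0 hC; have p0 : 0 < p by exact: lt_trans p1.
have q0 : 0 < p - 1 by rewrite subr_gt0.
apply: ge_ereal_sup => _ [r /= r1 <-].
pose s x := (nu x `^ (p - 1)^-1)^-1.
have s0 k : (1 <= k)%N -> 0 < s k by move=> k1; rewrite invr_gt0 powR_gt0 ?nu0.
set S := \sum_(1 <= x < r.+1) _; have S0 : 0 < S by exact: sum_nat_gt0 s0 _.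
have Sq0 : 0 < S `^ (p - 1) by exact: powR_gt0.
(* The extremal function of Hölder's inequality on [1, r]. *)
pose f y := if (y <= r)%N then s y else 0.
have rhsE : hardy_rhs p nu f = S%:E.
  rewrite /hardy_rhs (nneseries_split 1 r); last first.
    by move=> k k1; rewrite lee_fin mulr_ge0 ?powR_ge0// ltW ?nu0.
  rewrite add1n eseries0 ?adde0; last first.
    by move=> i ri _; rewrite /f leqNgt ri/= normr0 powR0 ?gt_eqF// mul0r.
  (* [s ^ (p-1) * nu = 1], so [s ^ p * nu = s]. *)
  rewrite sumEFin; congr EFin; apply: eq_big_nat => y /andP[y1 yr].
  have s0y := s0 _ y1.
  rewrite /f -ltnS yr gtr0_norm// -(mulr_powRB1 (ltW s0y) p0) -mulrA.
  rewrite [_ * nu y](_ : _ = 1) ?mulr1// /s -powRN -powRrM mulNr.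
  by rewrite mulVf ?gt_eqF// powR_inv1 ?ltW ?nu0// mulVf// gt_eqF ?nu0.
rewrite -lee_pdivlMr//; apply: nneseries_le => [n rn|n].
  by rewrite ltW// mu0// (leq_trans r1).
(* Multiplying by [S] turns [S ^ (p-1)] into [S ^ p] and the right side into [C] times
   [hardy_rhs]. *)
rewrite -EFinM lee_fin ler_pdivlMr// -(ler_pM2r S0) -mulrA [_ * S]mulrC.
rewrite mulr_powRB1 ?(ltW S0)// -lee_fin [(C * S)%:E]EFinM -rhsE; apply: le_trans (hC f).
apply: le_trans (nneseries_ge n _); last first.
  by move=> i i1; rewrite mulr_ge0 ?powR_ge0 ?ltW ?mu0.
(* Drop the terms with [x < r]; for [x >= r] the partial sums of [f] all equal [S]. *)
rewrite lee_fin mulr_suml (big_nat_widenl r 1)// [leRHS](bigID (leq r))/=.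
rewrite ler_wpDr//.
  by rewrite big_nat_cond sumr_ge0// => i /andP[/andP[i1 _] _]; rewrite mulr_ge0 ?powR_ge0 ?ltW ?mu0.
rewrite le_eqVlt; apply/orP; left; apply/eqP/eq_bigr => x rx.
suff -> : \sum_(1 <= y < x.+1) f y = S by rewrite gtr0_norm// mulrC.
rewrite (big_cat_nat _ (n := r.+1))//= [X in _ + X]big_nat [X in _ + X]big1 ?addr0.
  by apply: eq_big_nat => y /andP[_ yr]; rewrite /f -ltnS yr.
by move=> y /andP[ry _]; rewrite /f leqNgt ry.
Qed.

Local Open Scope ereal_scope.

(** * The upper bound for infinite sums, and the equivalence *)

Theorem proposition2p1 (R : realType) (p : R) (mu nu : nat -> R)
    (hp : (1 < p)%R)
    (hmu : forall n : nat, (1 <= n)%N -> (0 < mu n)%R)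
    (hnu : forall n : nat, (1 <= n)%N -> (0 < nu n)%R) :
  (hardy_const p mu nu < +oo <-> hardy_B1 p mu nu < +oo) /\
  (hardy_const p mu nu < +oo ->
     hardy_B1 p mu nu <= hardy_const p mu nu /\
     hardy_const p mu nu <=
       ((p `^ p / (p - 1) `^ (p - 1))%R)%:E * hardy_B1 p mu nu).
Proof.
have p0 : (0 < p)%R by exact: lt_trans hp.
have q0 : (0 < p - 1)%R by rewrite subr_gt0.
(* This needs no finiteness: without an admissible constant the infimum is [+oo]. *)
have lower : hardy_B1 p mu nu <= hardy_const p mu nu.
  by apply: le_ereal_inf_tmp => _ [C [_ hC] <-]; exact: hardy_B1_le.
set K := (p `^ p / (p - 1) `^ (p - 1))%R.
have K0 : (0 < K)%R by rewrite divr_gt0 ?powR_gt0.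
have upper : hardy_B1 p mu nu < +oo ->
    hardy_const p mu nu <= K%:E * hardy_B1 p mu nu /\ K%:E * hardy_B1 p mu nu < +oo.
  pose S r := (\sum_(1 <= x < r.+1) (nu x `^ (p - 1)^-1)^-1)%R.
  have S0 r : (1 <= r)%N -> (0 < S r)%R.
    move=> r1; apply: (sum_nat_gt0 (w := fun x => ((nu x `^ (p - 1)^-1)^-1)%R)) => //.
    by move=> n n1; rewrite invr_gt0 powR_gt0 ?hnu.
  have partial_le r n : (1 <= r)%N ->
      ((\sum_(r <= x < n) mu x) * S r `^ (p - 1))%:E <= hardy_B1 p mu nu.
    move=> r1; apply: le_trans (ereal_sup_ubound _); last by exists r.
    rewrite EFinM lee_wpmul2r ?lee_fin ?powR_ge0//; apply: nneseries_ge => i ri.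
    by rewrite ltW// hmu// (leq_trans r1).
  (* Positivity excludes [-oo] and makes [K * b] a positive candidate for [hardy_const_le]. *)
  have B0 : 0 < hardy_B1 p mu nu.
    apply: lt_le_trans (partial_le 1%N 2%N isT).
    by rewrite lte_fin mulr_gt0 ?powR_gt0 ?S0// sum_nat_gt0.
  case: (hardy_B1 p mu nu) B0 partial_le => [b||]// b0 partial_le _.
  rewrite -EFinM ltry; split => //; apply: hardy_const_le => [|f].
    by rewrite lte_fin mulr_gt0.
  apply: nneseries_le => [n n1|n]; first by rewrite mulr_ge0 ?powR_ge0 ?ltW ?hmu.
  apply: (@le_trans _ _ ((K * b)%:E * (\sum_(1 <= x < n) `|f x| `^ p * nu x)%:E)).
    rewrite -EFinM lee_fin; apply: hardy_finite => // r /andP[r1 _].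
    by rewrite -lee_fin; exact: partial_le.
  rewrite lee_wpmul2l ?lee_fin ?(ltW (mulr_gt0 K0 b0))//; apply: nneseries_ge => i i1.
  by rewrite mulr_ge0 ?powR_ge0 ?ltW ?hnu.
split; first split => [|/upper[CB]]; first exact: le_lt_trans lower.
  exact: le_lt_trans CB.
by move=> hC; split => //; apply: (upper (le_lt_trans lower hC)).1.
Qed.
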